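(* Let $M$ be a finitely generated $\mathbb{Z}^r$-graded $S$-module whose Hilbert series is supported on $\bigcup_k(\mathbf{b}_k+Q)$ for a finite collection of vectors $\mathbf{b}_k\in\mathbb{Z}^r$, and let $i\ge 0$. Then there exists a finite set of positive coarsening vectors $\mathcal{V}=\{\mathbf{v}_1,\ldots,\mathbf{v}_t\}$ such that $$\mathcal{D}_i(M)=\bigcap_{\mathbf{v}_j\in\mathcal{V}}\Big\{\mathbf{a}\in\bigcup_k(\mathbf{b}_k+Q)\ \Big|\ \mathbf{a}\cdot\mathbf{v}_j\le\operatorname{reg-num}_{\mathbf{v}_j}(M)+i s_{\mathbf{v}_j}+c_{\mathbf{v}_j}-1\Big\}.$$
   Context: Let $K$ be a field and $S=K[x_1,\ldots,x_n]$, with a $\mathbb{Z}^r$-grading given by $\deg(x_i)=\mathbf{a}_i\in\mathbb{Z}^r$. Let $Q\subseteq\mathbb{Z}^r$ be the subsemigroup (containing $0$) generated by $\mathbf{a}_1,\ldots,\mathbf{a}_n$. $S$ is assumed positively multigraded: $\deg(x_i)\ne 0$ for all $i$ and $Q$ has no nonzero invertible elements. A vector $\mathbf{v}\in\mathbb{Z}^r$ is a positive coarsening vector if $\deg_{\mathbf{v}}(x_i):=\mathbf{a}_i\cdot\mathbf{v}>0$ for all $i$. For a $\mathbb{Z}^r$-graded module $M$, $M^{[\mathbf{v}]}$ denotes $M$ with the $\mathbb{Z}$-grading $(M^{[\mathbf{v}]})_m=\bigoplus_{\mathbf{a}\cdot\mathbf{v}=m}M_{\mathbf{a}}$. Put $\mathfrak{m}=\langle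 x_1,\ldots,x_n\rangle$, $c_{\mathbf{v}}=\operatorname{lcm}(\deg_{\mathbf{v}}(x_1),\ldots,\deg_{\mathbf{v}}(x_n))$ and $s_{\mathbf{v}}=\max\{nc_{\mathbf{v}}-\sum_{i=1}^n\deg_{\mathbf{v}}(x_i),\ c_{\mathbf{v}}\}$. Define $$\operatorname{reg}_{\mathbf{v}}(M)=\{p\in\mathbb{Z}\mid H^i_{\mathfrak{m}}(M^{[\mathbf{v}]})_q=0\ \text{for all } i\ge 0 \text{ and all } q\in p+(1-i)c_{\mathbf{v}}+\mathbb{N}c_{\mathbf{v}}\},$$ where $\mathbb{N}$ contains $0$, and $\operatorname{reg-num}_{\mathbf{v}}(M)=\inf\{p\in\operatorname{reg}_{\mathbf{v}}(M)\mid q\in\operatorname{reg}_{\mathbf{v}}(M)\text{ for all } q\ge p\}$ (which is $-\infty$ if $M=0$). The Hilbert series of $M$ is supported on $\bigcup_k(\mathbf{b}_k+Q)$ if $M_{\mathbf{a}}\ne 0$ implies $\mathbf{a}\in\bigcup_k(\mathbf{b}_k+Q)$; such a finite collection of $\mathbf{b}_k$ exists for every finitely generated $M$ and is fixed. Finally, $$\mathcal{D}_i(M):=\bigcap_{\mathbf{v}}\Big\{\mathbf{a}\in\bigcup_k(\mathbf{b}_k+Q)\ \Big|\ \mathbf{a}\cdot\mathbf{v}\le\operatorname{reg-num}_{\mathbf{v}}(M)+i s_{\mathbf{v}}+c_{\mathbf{v}}-1\Big\},$$ the intersection being over all positive coarsening vectors $\mathbf{v}$ of $S$. *)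

(* Defs.v *)
From HB Require Import structures.
From mathcomp Require Import all_boot all_order all_algebra.
(* mpoly must be imported before the mathcomp.classical files: in the other
   order their notation levels clash. *)
From mathcomp Require Import mpoly.
From mathcomp Require Import boolp classical_sets cardinality fsbigop.
From mathcomp Require Import constructive_ereal.

Set Implicit Arguments.
Unset Strict Implicit.
Unset Printing Implicit Defensive.

Import Order.TTheory GRing.Theory Num.Theory.
Local Open Scope classical_set_scope.
Local Open Scope ring_scope.

Section GradedModules.
Context (K : fieldType) (n : nat).
Notation S := {mpoly K[n]}.

Section FixedGrading.
Context (G : zmodType) (d : 'I_n -> G).

Definition poly_piece (g : G) : set S :=
  [set p | forall m, m \in msupp p -> \sum_(i < n) d i *+ m i = g].

(* [Mg] makes [M] a [G]-graded module over [S], graded by [deg 'X_i = d i]: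
   the [Mg g] are additive subgroups, [M] is their internal direct sum, and
   multiplication adds degrees. *)
Record is_graded (M : lmodType S) (Mg : G -> set M) : Prop := {
  graded0 : forall g, Mg g 0;
  gradedB : forall g x y, Mg g x -> Mg g y -> Mg g (x - y);
  gradedZ : forall g h p x, poly_piece g p -> Mg h x -> Mg (g + h) (p *: x);
  graded_direct : forall x, exists! f : G -> M,
    [/\ finite_set [set g | f g != 0], forall g, Mg g (f g)
      & x = \sum_(g \in [set: G]) f g]
}.

Definition graded_hom (A B : lmodType S) (Ag : G -> set A) (Bg : G -> set B)
    (f : {linear A -> B}) : Prop :=
  forall g x, Ag g x -> Bg g (f x).

Definition graded_injective (E : lmodType S) (Eg : G -> set E) : Prop :=
  forall (A B : lmodType S) (Ag : G -> set A) (Bg : G -> set B),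
    is_graded Ag -> is_graded Bg ->
  forall (j : {linear A -> B}) (f : {linear A -> E}),
    graded_hom Ag Bg j -> graded_hom Ag Eg f -> injective j ->
  exists h : {linear B -> E}, graded_hom Bg Eg h /\ forall x, h (j x) = f x.

(* 0 -> M -> E 0 -> E 1 -> ... is exact, the maps are graded of degree 0 and
   the [E i] are injective objects of the category of graded modules. *)
Record is_graded_injective_resolution (M : lmodType S) (Mg : G -> set M)
    (E : nat -> lmodType S) (Eg : forall i, G -> set (E i))
    (eps : {linear M -> E 0%N}) (dlt : forall i, {linear E i -> E i.+1}) :
    Prop := {
  resolution_graded : forall i, is_graded (Eg i);
  resolution_injective : forall i, graded_injective (Eg i);
  resolution_hom0 : graded_hom Mg (Eg 0%N) eps;
  resolution_hom : forall i, graded_hom (Eg i) (Eg i.+1) (dlt i);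
  resolution_exactM : injective eps;
  resolution_exact0 : [set y | dlt 0%N y = 0] = range eps;
  resolution_exact : forall i, [set y | dlt i.+1 y = 0] = range (dlt i)
}.

Definition irrelevant_ideal : set S :=
  [set p | exists c : 'I_n -> S, p = \sum_(i < n) c i * 'X_i].

(* Gamma_m(M): the elements killed by a power of the irrelevant ideal m
   (m^k is generated by the products of k elements of m). *)
Definition torsion (M : lmodType S) : set M :=
  [set x | exists k : nat, forall p : 'I_k -> S,
     (forall j, irrelevant_ideal (p j)) -> (\prod_(j < k) p j) *: x = 0].

(* Degree q cycles and boundaries in cohomological degree i of the complex
   Gamma_m(E 0) -> Gamma_m(E 1) -> ... *)
Definition torsion_cycles (E : nat -> lmodType S)
    (Eg : forall i, G -> set (E i)) (dlt : forall i, {linear E i -> E i.+1})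
    (i : nat) (q : G) : set (E i) :=
  [set x | [/\ Eg i q x, torsion x & dlt i x = 0]].

Definition torsion_boundaries (E : nat -> lmodType S)
    (Eg : forall i, G -> set (E i)) (dlt : forall i, {linear E i -> E i.+1})
    (i : nat) (q : G) : set (E i) :=
  match i return set (E i) with
  | 0%N => [set 0]
  | j.+1 => dlt j @` [set y | Eg j q y /\ torsion y]
  end.

Arguments torsion_cycles {E} Eg dlt i q.
Arguments torsion_boundaries {E} Eg dlt i q.

(* H^i_m(M)_q = 0, where H^i_m is the i-th right derived functor of Gamma_m on
   graded modules.  Graded modules have enough injectives and the cohomology
   does not depend on the resolution, so "for every resolution" and "for some
   resolution" agree. *)
Definition local_cohomology_vanishes (M : lmodType S) (Mg : G -> set M)
    (i : nat) (q : G) : Prop :=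
  forall (E : nat -> lmodType S) (Eg : forall i, G -> set (E i))
    (eps : {linear M -> E 0%N}) (dlt : forall i, {linear E i -> E i.+1}),
    is_graded_injective_resolution Mg Eg eps dlt ->
    torsion_cycles Eg dlt i q = torsion_boundaries Eg dlt i q.

End FixedGrading.

Definition finitely_generated (M : lmodType S) : Prop :=
  exists (k : nat) (g : 'I_k -> M),
    forall x, exists c : 'I_k -> S, x = \sum_(j < k) c j *: g j.

End GradedModules.

Section Degrees.
Context (n r : nat) (a : 'I_n -> 'rV[int]_r).

Definition dot (u v : 'rV[int]_r) : int := \sum_(j < r) u 0 j * v 0 j.

Definition degree_semigroup : set 'rV[int]_r :=
  [set u | exists k : 'I_n -> nat, u = \sum_(i < n) a i *+ k i].

Definition positively_multigraded : Prop :=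
  (forall i, a i != 0) /\
  (forall u, degree_semigroup u -> degree_semigroup (- u) -> u = 0).

Definition vdeg (v : 'rV[int]_r) (i : 'I_n) : int := dot (a i) v.

Definition positive_coarsening : set 'rV[int]_r :=
  [set v | forall i, 0 < vdeg v i].

(* Used only for positive [v], where the absolute values change nothing. *)
Definition c_ (v : 'rV[int]_r) : int :=
  (\big[lcmn/1%N]_(i < n) `|vdeg v i|%N)%:Z.

Definition s_ (v : 'rV[int]_r) : int :=
  Num.max (n%:Z * c_ v - \sum_(i < n) vdeg v i) (c_ v).

Definition shifted_semigroups (t : nat) (b : 'I_t -> 'rV[int]_r) :
    set 'rV[int]_r :=
  \bigcup_(k in [set: 'I_t]) [set b k + u | u in degree_semigroup].

End Degrees.

Section Regularity.
Context (K : fieldType) (n r : nat) (a : 'I_n -> 'rV[int]_r).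
Context (M : lmodType {mpoly K[n]}) (Mg : 'rV[int]_r -> set M).

(* The Z-grading of M^[v]. *)
Definition coarsen (v : 'rV[int]_r) (m : int) : set M :=
  [set x | exists f : 'rV[int]_r -> M,
     [/\ finite_set [set u | f u != 0], forall u, Mg u (f u)
       & x = \sum_(u \in [set u | dot u v = m]) f u]].

Definition reg (v : 'rV[int]_r) : set int :=
  [set p | forall i k : nat,
     local_cohomology_vanishes (vdeg a v) (coarsen v) i
       (p + (1 - i%:Z) * c_ a v + k%:Z * c_ a v)].

(* Infimum in the extended integers; the default value +oo is that of the
   empty set. *)
Definition reg_num (v : 'rV[int]_r) : \bar int :=
  infimum +oo%E
    [set (p%:E)%E | p in [set p | reg v p /\ forall q, p <= q -> reg v q]].

Definition hilbert_series_supported_on (U : set 'rV[int]_r) : Prop :=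
  forall u, Mg u <> [set 0] -> U u.

Definition reg_region (U : set 'rV[int]_r) (i : nat) (v : 'rV[int]_r) :
    set 'rV[int]_r :=
  [set u | U u /\
    ((dot u v)%:E <= reg_num v + (i%:Z * s_ a v + c_ a v - 1)%:E)%E].

Definition D_ (U : set 'rV[int]_r) (i : nat) : set 'rV[int]_r :=
  \bigcap_(v in positive_coarsening a) reg_region U i v.

End Regularity.

(* Main.v *)
Require Import Defs.
From HB Require Import structures.
From mathcomp Require Import all_boot all_order all_algebra.
From mathcomp Require Import mpoly.
From mathcomp Require Import boolp classical_sets cardinality fsbigop.
From mathcomp Require Import constructive_ereal.

Set Implicit Arguments.
Unset Strict Implicit.
Unset Printing Implicit Defensive.

Import Order.TTheory GRing.Theory Num.Theory.
Local Open Scope classical_set_scope.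
Local Open Scope ring_scope.

(** Let [U] be the union of the [b_k + Q].  A positive coarsening vector [v]
    gives every generator [a_i] of [Q] degree at least 1, so only finitely many
    points of [U] have [v]-degree at most a given integer
    ([finite_shifted_semigroups_dot_le]).  Hence the region cut out by [v] is
    finite as soon as reg-num_v(M) is not [+oo]; it is empty if reg-num_v(M)
    is [-oo].

    If some [v0] has a finite region, then [D_i(M)] is an intersection of a
    family with a finite member: besides [v0] it suffices to take, for each of
    the finitely many points of the region of [v0] lying outside [D_i(M)], one
    vector whose region misses that point ([bigcap_finite_subfamily]).

    If on the contrary reg-num_v(M) is [+oo] for all [v], then every region is
    equal to [U], and any single vector will do; when there is no positive
    coarsening vector at all, both intersections are over the empty family. *)

(** One index is enough to discard one point, so a finite member of the family
    leaves only finitely many indices to choose. *)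
Lemma bigcap_finite_subfamily (I T : Type) (A : set I) (F : I -> set T)
    (i0 : I) :
  A i0 -> finite_set (F i0) ->
  exists V : set I, [/\ finite_set V, V `<=` A
    & \bigcap_(i in A) F i = \bigcap_(i in V) F i].
Proof.
move=> Ai0 finF.
have /choice[g gP] : forall x, exists i,
    A i /\ (F i x -> (\bigcap_(i in A) F i) x).
  move=> x; have [Dx|nDx] := pselect ((\bigcap_(i in A) F i) x).
    by exists i0.
  apply: contrapT => noi; apply: nDx => i Ai; apply: contrapT => nFix.
  by apply: noi; exists i.
exists (i0 |` g @` F i0); split.
- by rewrite finite_setU; split; [exact: finite_set1|exact: finite_image].
- by move=> _ [->|[x _ <-]] //; have [] := gP x.
- apply/seteqP; split=> [x Dx i|x Vx].
    by move=> [->|[y _ <-]]; apply: Dx => //; have [] := gP y.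
  have [_] := gP x; apply; apply: (Vx); right; exists x => //.
  by apply: Vx; left.
Qed.

Section PositiveCoarsening.
Context (n r : nat) (a : 'I_n -> 'rV[int]_r).

Lemma dotDl (u w v : 'rV[int]_r) : dot (u + w) v = dot u v + dot w v.
Proof. by rewrite -big_split; apply: eq_bigr => j _; rewrite mxE mulrDl. Qed.

Lemma dot_sum_generators (k : 'I_n -> nat) (v : 'rV[int]_r) :
  dot (\sum_(i < n) a i *+ k i) v = \sum_(i < n) vdeg a v i *+ k i.
Proof.
rewrite /vdeg /dot; under [RHS]eq_bigr do rewrite -sumrMnl.
rewrite exchange_big; apply: eq_bigr => j _ /=.
by rewrite summxE mulr_suml; apply: eq_bigr => i _; rewrite mulmxnE mulrnAl.
Qed.

Lemma exponent_le_dot (v : 'rV[int]_r) (k : 'I_n -> nat) (i : 'I_n) :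
  positive_coarsening a v -> (k i)%:Z <= dot (\sum_(i < n) a i *+ k i) v.
Proof.
move=> vpos; rewrite dot_sum_generators (bigD1 i) //= -[leLHS]addr0 lerD //.
  by rewrite -[leLHS]natz ler_wMn2r // -gtz0_ge1; exact: vpos.
by apply: sumr_ge0 => j _; rewrite mulrn_wge0 // ltW //; exact: vpos.
Qed.

Lemma finite_shifted_semigroups_dot_le (t : nat) (b : 'I_t -> 'rV[int]_r)
    (v : 'rV[int]_r) (N : int) :
  positive_coarsening a v ->
  finite_set [set u | shifted_semigroups a b u /\ dot u v <= N].
Proof.
move=> vpos.
(* On [b k + Q] the bound on the degree bounds every exponent by
   [N - b k . v], so exponent vectors range over a finite type. *)
pose E k := `|N - dot (b k) v|%N.+1.
pose point k (e : {ffun 'I_n -> 'I_(E k)}) := b k + \sum_(i < n) a i *+ e i.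
apply: (@sub_finite_set _ _ (\bigcup_(k in [set: 'I_t]) range (point k))).
  move=> _ [[k _ [_ [e ->] <-]]]; rewrite dotDl -lerBrDl => le_dot.
  have ltE i : (e i < E k)%N.
    rewrite /E ltnS -lez_nat.
    by apply: le_trans (ler_norm _); apply: le_trans le_dot; exact: exponent_le_dot.
  exists k => //; exists [ffun i => Ordinal (ltE i)] => //.
  by congr (_ + _); apply: eq_bigr => i _; rewrite ffunE.
by apply: bigcup_finite => // k _; exact: finite_image.
Qed.

End PositiveCoarsening.

Section Regions.
Context (K : fieldType) (n r : nat) (a : 'I_n -> 'rV[int]_r).
Context (M : lmodType {mpoly K[n]}) (Mg : 'rV[int]_r -> set M).

Lemma reg_region_infinite_reg_num (U : set 'rV[int]_r) (i : nat)
    (v : 'rV[int]_r) :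
  reg_num a Mg v = +oo%E -> reg_region a Mg U i v = U.
Proof.
move=> regv; apply/seteqP; split=> [u []//|u Uu].
by split; rewrite // regv addye // leey.
Qed.

Lemma finite_reg_region (t : nat) (b : 'I_t -> 'rV[int]_r) (i : nat)
    (v : 'rV[int]_r) :
  positive_coarsening a v -> reg_num a Mg v <> +oo%E ->
  finite_set (reg_region a Mg (shifted_semigroups a b) i v).
Proof.
move=> vpos; rewrite /reg_region; case: (reg_num a Mg v) => [p||] // _.
  apply: sub_finite_set (finite_shifted_semigroups_dot_le b _ vpos).
  by move=> u [Uu]; rewrite -EFinD lee_fin => le_dot; split; last exact: le_dot.
by apply: sub_finite_set (finite_set0 _) => u [_]; rewrite addNye.
Qed.

End Regions.

Theorem theorem3p12 (K : fieldType) (n r : nat) (a : 'I_n -> 'rV[int]_r)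
    (ha : positively_multigraded a)
    (M : lmodType {mpoly K[n]}) (Mg : 'rV[int]_r -> set M)
    (hM : is_graded a Mg) (hfg : finitely_generated M)
    (t : nat) (b : 'I_t -> 'rV[int]_r)
    (hb : hilbert_series_supported_on Mg (shifted_semigroups a b))
    (i : nat) :
  exists V : set 'rV[int]_r,
    [/\ finite_set V, V `<=` positive_coarsening a
      & D_ a Mg (shifted_semigroups a b) i =
        \bigcap_(v in V) reg_region a Mg (shifted_semigroups a b) i v].
Proof.
have [[v0 [v0pos regv0]]|allinf] :=
  pselect (exists v, positive_coarsening a v /\ reg_num a Mg v <> +oo%E).
  exact: bigcap_finite_subfamily v0pos (finite_reg_region b i v0pos regv0).
have region_eq v : positive_coarsening a v ->
    reg_region a Mg (shifted_semigroups a b) i v = shifted_semigroups a b.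
  move=> vpos; apply: reg_region_infinite_reg_num; apply: contrapT => regv.
  by apply: allinf; exists v.
have [[v0 v0pos]|nov] := pselect (exists v, positive_coarsening a v).
  exists [set v0]; split=> [|_ -> //|]; first exact: finite_set1.
  rewrite bigcap_set1 region_eq //; apply/seteqP; split=> [u Du|u Uu v vpos].
    by rewrite -(region_eq v0) //; exact: Du.
  by rewrite region_eq.
exists set0; split=> //; rewrite bigcap_set0.
by apply/seteqP; split=> // u _ v vpos; case: nov; exists v.
Qed.
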